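(* Let $c_1,\dots,c_k\in\mathbb{R}^d$ ($k\ge2$) be distinct fixed centers and let $X,X'\in(\mathbb{R}^d)^n$ satisfy $\|X-X'\|\le\varepsilon$. If $\varepsilon<\gamma_{\min}/2$, where $\gamma_{\min}$ is the minimum margin of $X$, then no point changes its assigned center, i.e. $\ell(x_i')=\ell(x_i)$ for every $i\in[n]$, and consequently $A(X')=A(X)$.
   Context: Here $n\ge 2$, $[n]=\{1,\dots,n\}$, and $\|\cdot\|$ on $\mathbb{R}^d$ is the Euclidean norm. Configurations are ordered tuples $X=(x_1,\dots,x_n)$, $X'=(x_1',\dots,x_n')$ in $(\mathbb{R}^d)^n$, and $\|X-X'\|=\max_{1\le i\le n}\|x_i-x_i'\|$. Nearest-center assignment with a deterministic tie-breaking rule: a fixed function $\ell:\mathbb{R}^d\to\{1,\dots,k\}$ with $\|x-c_{\ell(x)}\|\le\|x-c_j\|$ for all $x\in\mathbb{R}^d$ and all $j$; the point $x$ is assigned to the center $c_{\ell(x)}$. The same centers and the same $\ell$ are used for $X$ and $X'$. The induced partition $A(X)$ of $[n]$ is the one in which $i,j$ lie in the same block if and only if $\ell(x_i)=\ell(x_j)$. Write $\ell_i=\ell(x_i)$. The margin of $x_i$ is $\gamma_i=\min_{j\ne\ell_i}\bigl(\|x_i-c_j\|-\|x_i-c_{\ell_i}\|\bigr)$, and $\gamma_{\min}=\min_{1\le i\le n}\gamma_i$. *)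

(* Defs.v *)
From mathcomp Require Import all_boot all_order all_algebra.
From mathcomp Require Import reals.

Set Implicit Arguments.
Unset Strict Implicit.
Unset Printing Implicit Defensive.

Import Order.TTheory GRing.Theory Num.Theory.
Local Open Scope ring_scope.

(* Not the library norm [`|v|] of row vectors, which is the sup norm. *)
Definition enorm (R : realType) (d : nat) (v : 'rV[R]_d) : R :=
  Num.sqrt (\sum_(j < d) v 0 j ^+ 2).

Definition config (R : realType) (d n : nat) := n.-tuple 'rV[R]_d.

(* The default 0 of the iterated maximum is harmless since norms are
   nonnegative. *)
Definition config_dist (R : realType) (d n : nat) (X X' : config R d n) : R :=
  \big[Num.max/0]_(i < n) enorm (tnth X i - tnth X' i).

(* Iterated minima over R need a default element: we use the value of F at some
   index satisfying P, so that this is the minimum of the F i with P i as soon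
   as one such i exists (see [min_over_le] and [min_over_attained]), and 0
   otherwise. *)
Definition min_over (R : realType) (I : finType) (P : pred I) (F : I -> R) : R :=
  if [pick i | P i] is Some i0 then \big[Num.min/F i0]_(i | P i) F i else 0.

Lemma min_over_le (R : realType) (I : finType) (P : pred I) (F : I -> R) (i : I) :
  P i -> min_over P F <= F i.
Proof.
rewrite /min_over => Pi; case: pickP => [i0 _|/(_ i)]; last by rewrite Pi.
exact: bigmin_le_cond.
Qed.

Lemma min_over_attained (R : realType) (I : finType) (P : pred I) (F : I -> R) :
  (exists i, P i) -> exists2 i, P i & min_over P F = F i.
Proof.
rewrite /min_over => -[i Pi]; case: pickP => [i0 Pi0|/(_ i)]; last by rewrite Pi.
by apply: (big_rec (fun m => exists2 i, P i & m = F i)) => [|j m Pj [j' Pj' ->]];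
  [exists i0 | rewrite minEle; case: ifP => _; [exists j | exists j']].
Qed.

(* [l] sends every point of the space to the index of a nearest center; ties
   are broken by the choice of the function [l]. *)
Definition nearest_center_rule (R : realType) (d k : nat)
    (c : 'I_k -> 'rV[R]_d) (l : 'rV[R]_d -> 'I_k) : Prop :=
  forall (x : 'rV[R]_d) (j : 'I_k), enorm (x - c (l x)) <= enorm (x - c j).

Definition margin (R : realType) (d k : nat)
    (c : 'I_k -> 'rV[R]_d) (l : 'rV[R]_d -> 'I_k) (x : 'rV[R]_d) : R :=
  min_over (fun j : 'I_k => j != l x)
    (fun j : 'I_k => enorm (x - c j) - enorm (x - c (l x))).

Definition min_margin (R : realType) (d k n : nat)
    (c : 'I_k -> 'rV[R]_d) (l : 'rV[R]_d -> 'I_k) (X : config R d n) : R :=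
  min_over (fun _ : 'I_n => true) (fun i : 'I_n => margin c l (tnth X i)).

Definition induced_partition (R : realType) (d k n : nat)
    (l : 'rV[R]_d -> 'I_k) (X : config R d n) : {set {set 'I_n}} :=
  preim_partition (fun i : 'I_n => l (tnth X i)) [set: 'I_n].

(* Main.v *)
Require Import Defs.
From mathcomp Require Import all_boot all_order all_algebra.
From mathcomp Require Import reals.
From mathcomp Require Import ring lra.

(** A displacement of a point by at most [eps] changes its distance to each
    center by at most [eps], by the triangle inequality, hence changes each
    difference of two such distances by at most [2 * eps].  Every difference
    entering a margin exceeds [2 * eps], so it stays positive: the assigned
    center of the original point remains strictly nearer to the displaced point
    than any other center, and a nearest-center rule has no choice but to pick
    it, whatever its tie-breaking.  The partition is determined by the
    assignments, so it is unchanged too.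

    The analytic input is the triangle inequality for the Euclidean norm
    ([ler_enormD]), which rests on the Cauchy-Schwarz inequality
    ([cauchy_schwarz_sum]); the geometric step is
    [nearest_center_stable]. *)

Set Implicit Arguments.
Unset Strict Implicit.
Unset Printing Implicit Defensive.

Import Order.TTheory GRing.Theory Num.Theory.
Local Open Scope ring_scope.

(** Lagrange's identity: twice the difference of the two sides is the sum of
    the squares [(a i * b j - a j * b i) ^+ 2] over all pairs [i, j]. *)
Lemma cauchy_schwarz_sum (R : realDomainType) (I : finType) (a b : I -> R) :
  (\sum_i a i * b i) ^+ 2 <= (\sum_i a i ^+ 2) * (\sum_i b i ^+ 2).
Proof.
have lagrange : \sum_i \sum_j (a i * b j - a j * b i) ^+ 2 =
    ((\sum_i a i ^+ 2) * (\sum_i b i ^+ 2) - (\sum_i a i * b i) ^+ 2) *+ 2.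
  transitivity (\sum_i \sum_j (a i ^+ 2 * b j ^+ 2 + b i ^+ 2 * a j ^+ 2
                               - (a i * b i) * (a j * b j) *+ 2)).
    by apply: eq_bigr => i _; apply: eq_bigr => j _; ring.
  under eq_bigr => i _ do
    rewrite sumrB big_split /= sumrMnl -!mulr_sumr.
  rewrite sumrB big_split /= sumrMnl -!mulr_suml.
  ring.
rewrite -subr_ge0 -(pmulrn_lge0 _ (isT : (0 < 2)%N)) -lagrange.
by apply: sumr_ge0 => i _; apply: sumr_ge0 => j _; apply: sqr_ge0.
Qed.

Section EuclideanSpace.
Variables (R : realType) (d : nat).
Implicit Types u v w : 'rV[R]_d.

Lemma enorm_ge0 v : 0 <= enorm v.
Proof. exact: sqrtr_ge0. Qed.

Lemma sqr_enorm v : enorm v ^+ 2 = \sum_j v 0 j ^+ 2.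
Proof. by rewrite sqr_sqrtr // sumr_ge0 // => j _; apply: sqr_ge0. Qed.

Lemma enormN v : enorm (- v) = enorm v.
Proof. by rewrite /enorm; under eq_bigr do rewrite mxE sqrrN. Qed.

(** After squaring, the two sides differ only in the cross terms, which
    Cauchy-Schwarz compares. *)
Lemma ler_enormD u v : enorm (u + v) <= enorm u + enorm v.
Proof.
have dot_le : \sum_j u 0 j * v 0 j <= enorm u * enorm v.
  apply: le_trans (ler_norm _) _.
  rewrite -ler_sqr ?nnegrE ?normr_ge0 ?mulr_ge0 ?enorm_ge0 //.
  by rewrite real_normK ?num_real // exprMn !sqr_enorm cauchy_schwarz_sum.
rewrite -ler_sqr ?nnegrE ?addr_ge0 ?enorm_ge0 // sqrrD !sqr_enorm.
under eq_bigr do rewrite mxE sqrrD.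
by rewrite big_split big_split /= sumrMnl lerD2r lerD2l lerMn2r.
Qed.

Lemma enorm_distC u v : enorm (u - v) = enorm (v - u).
Proof. by rewrite -opprB enormN. Qed.

Lemma ler_enorm_dist u v w : enorm (u - w) <= enorm (u - v) + enorm (v - w).
Proof. by rewrite -[u - w](subrKA v) ler_enormD. Qed.

(** Comparing [x'] with its own center [c (l x')] and with the old one
    [c (l x)]: each comparison loses one displacement against the distances
    from [x], whence the factor [2]. *)
Lemma nearest_center_stable (k : nat) (c : 'I_k -> 'rV[R]_d)
    (l : 'rV[R]_d -> 'I_k) (x x' : 'rV[R]_d) :
  nearest_center_rule c l -> enorm (x - x') < margin c l x / 2 -> l x' = l x.
Proof.
move=> nearest small; apply/eqP/negPn/negP => moved.
have gap : margin c l x <= enorm (x - c (l x')) - enorm (x - c (l x)).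
  exact: (min_over_le (fun j => enorm (x - c j) - enorm (x - c (l x))) moved).
have chosen := nearest x' (l x).
have far := ler_enorm_dist x x' (c (l x')).
have near := ler_enorm_dist x' x (c (l x)).
rewrite (enorm_distC x' x) in near.
lra.
Qed.

Lemma enorm_le_config_dist (n : nat) (X X' : config R d n) (i : 'I_n) :
  enorm (tnth X i - tnth X' i) <= config_dist X X'.
Proof. exact: (le_bigmax _ (fun i => enorm (tnth X i - tnth X' i))). Qed.

Lemma min_margin_le (k n : nat) (c : 'I_k -> 'rV[R]_d) (l : 'rV[R]_d -> 'I_k)
    (X : config R d n) (i : 'I_n) :
  min_margin c l X <= margin c l (tnth X i).
Proof. exact: (min_over_le (fun i => margin c l (tnth X i))). Qed.

Lemma eq_induced_partition (k n : nat) (l : 'rV[R]_d -> 'I_k)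
    (X X' : config R d n) :
  (forall i, l (tnth X' i) = l (tnth X i)) ->
  induced_partition l X' = induced_partition l X.
Proof.
move=> same; apply: eq_imset => i; apply/setP => j.
by rewrite !inE !same.
Qed.

End EuclideanSpace.

Theorem proposition5p3 (R : realType) (d n k : nat)
    (hn : (2 <= n)%N) (hk : (2 <= k)%N)
    (c : 'I_k -> 'rV[R]_d) (hc : injective c)
    (l : 'rV[R]_d -> 'I_k) (hl : nearest_center_rule c l)
    (X X' : config R d n) (eps : R)
    (hXX' : config_dist X X' <= eps)
    (heps : eps < min_margin c l X / 2) :
  (forall i : 'I_n, l (tnth X' i) = l (tnth X i)) /\
  induced_partition l X' = induced_partition l X.
Proof.
have same i : l (tnth X' i) = l (tnth X i).
  apply: (nearest_center_stable hl).
  have moved := enorm_le_config_dist X X' i.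
  have gap := min_margin_le c l X i.
  lra.
by split=> //; apply: eq_induced_partition.
Qed.
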